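(* For every fixed positive integer $\ell$ we have $\mathrm{ind}(k,\ell) \le \frac{3}{4} + o_k(1)$, that is, for every $\varepsilon > 0$ there exists $k_0 = k_0(\ell,\varepsilon)$ such that $\mathrm{ind}(k,\ell) \le \frac34 + \varepsilon$ for all integers $k \ge k_0$. Moreover, for $\ell = 1$ we have $\mathrm{ind}(k,1) \le \frac{1}{2} + o_k(1)$, that is, for every $\varepsilon > 0$ there exists $k_0 = k_0(\varepsilon)$ such that $\mathrm{ind}(k,1) \le \frac12 + \varepsilon$ for all integers $k \ge k_0$.
   Context: All graphs are finite and simple. For a positive integer $k$ and a graph $G$ with at least $k$ vertices, let $A = A_{G,k}$ be chosen uniformly at random from all $k$-element subsets of $V(G)$, and let $X_{G,k} = e(G[A])$ be the number of edges of $G$ with both endpoints in $A$. For integers $n \ge k$ and $0 \le \ell \le \binom{k}{2}$ let $I(n,k,\ell) = \max\{\mathbb{P}(X_{G,k} = \ell) : G \text{ is a graph on } n \text{ vertices}\}$. For fixed $k,\ell$ the sequence $I(n,k,\ell)$ is non-increasing in $n$, and the edge-inducibility is defined by $\mathrm{ind}(k,\ell) := \lim_{n\to\infty} I(n,k,\ell)$. *)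

(* Defs.v *)
From HB Require Import structures.
From mathcomp Require Import all_boot all_order all_algebra.
From mathcomp Require Import all_classical all_reals all_analysis.
Set Implicit Arguments.
Unset Strict Implicit.
Unset Printing Implicit Defensive.
Import Order.TTheory GRing.Theory Num.Theory.
Import numFieldNormedType.Exports.
Local Open Scope ring_scope.

(* A graph on the vertex type V is given by its edge set E, a set of
   two-element subsets of V; this makes it finite, simple and loopless. *)
Definition simple_graph (V : finType) (E : {set {set V}}) : bool :=
  [forall e in E, #|e| == 2%N].

Definition induced_edges (V : finType) (E : {set {set V}}) (A : {set V}) :
    {set {set V}} :=
  [set e in E | e \subset A].

Definition ksubsets (V : finType) (k : nat) : {set {set V}} :=
  [set A : {set V} | #|A| == k].

Definition prob_edges (R : realType) (V : finType) (E : {set {set V}})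
    (k l : nat) : R :=
  #|[set A in ksubsets V k | #|induced_edges E A| == l]|%:R
  / #|ksubsets V k|%:R.

(* The default value 0 of the maximum is harmless: the empty graph is always in
   the range and probabilities are nonnegative. For n < k there is no k-subset
   and the value is 0 / 0 = 0, which does not affect the limit. *)
Definition max_prob (R : realType) (n k l : nat) : R :=
  \big[Num.max/0]_(E : {set {set 'I_n}} | simple_graph E) prob_edges R E k l.

(* The sequence is nonincreasing for n >= k and bounded below by 0, so the
   limit exists. *)
Definition ind (R : realType) (k l : nat) : R :=
  limn (fun n : nat => max_prob R n k l).

(* Main.v *)
Require Import Defs.
From HB Require Import structures.
From mathcomp Require Import all_boot all_order all_algebra.
From mathcomp Require Import all_classical all_reals all_analysis.
From mathcomp Require Import fintype finset zify ring lra.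
Set Implicit Arguments.
Unset Strict Implicit.
Unset Printing Implicit Defensive.
Import Order.TTheory GRing.Theory Num.Theory.
Import numFieldNormedType.Exports.
Local Open Scope ring_scope.

(* Let U be a uniformly random subset (of random size) of a vertex set W with
   N elements. If uv is an edge inside W, then adding both u and v to a set
   avoiding them strictly increases the number of induced edges, so e(U) = l has
   probability at most 3/4 when l > 0; for l = 1 an induction on W improves this
   to 1/2. Averaging over W, the probabilities p_m = P(X_{G,m} = l) satisfy
   E[p_M] <= 3/4 (resp. 1/2) for M ~ Bin(N, 1/2).
   Conversely, deleting k - m random vertices from a k-set with exactly l edges
   destroys none of them with probability at least 1 - 2l(k - m)/k, so
   p_m >= (1 - 2l(k - m)/k) p_k for m <= k. With N = 2(k - t) and
   sqrt k << t << k, M lies in [k - 2t, k] with high probability, and the two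
   facts together bound p_k. *)

(** * Induced edges and the subsets of a fixed set *)

Lemma induced_edgesS (V : finType) (E : {set {set V}}) (A B : {set V}) :
  A \subset B -> induced_edges E A \subset induced_edges E B.
Proof.
move=> sAB; apply/subsetP => e; rewrite !inE => /andP[-> /= eA].
exact: subset_trans sAB.
Qed.

Lemma ltn_induced_edges (V : finType) (E : {set {set V}}) (e A B : {set V}) :
  e \in E -> A \subset B -> e \subset B -> ~~ (e \subset A) ->
  (#|induced_edges E A| < #|induced_edges E B|)%N.
Proof.
move=> eE sAB eB eA; apply: proper_card; apply/properP; split.
  exact: induced_edgesS.
by exists e; rewrite inE eE ?eB // (negbTE eA).
Qed.

(** Subsets of [W] are paired according to whether they contain [u]. A second use at [v] groups them
    into quadruples [U], [U + u], [U + v], [U + u + v]. *)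
Lemma sum_subsets_pick (V : finType) (W : {set V}) (u : V)
    (F : {set V} -> nat) : u \in W ->
  (\sum_(U : {set V} | U \subset W) F U =
   \sum_(U : {set V} | U \subset W :\ u) (F U + F (u |: U)))%N.
Proof.
move=> uW; rewrite big_split /= (bigID (fun U : {set V} => u \in U)) /= addnC.
congr addn; first by apply: eq_bigl => U; rewrite subsetD1.
rewrite (reindex_onto (fun U : {set V} => u |: U) (fun U => U :\ u)) /=; last first.
  by move=> U /andP[_ uU]; rewrite setD1K.
apply: eq_bigl => U; rewrite subUset sub1set uW setU11 andbT /= subsetD1.
congr andb; apply/eqP/idP => [<-|uU]; first by rewrite !inE eqxx.
exact: setU1K.
Qed.

Lemma no_induced_edges (V : finType) (E : {set {set V}}) (W U : {set V}) :
  [forall e in E, ~~ (e \subset W)] -> U \subset W -> #|induced_edges E U| = 0%N.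
Proof.
move=> /forallP noW sUW; apply/eqP; rewrite cards_eq0; apply/eqP/setP => e.
rewrite !inE; apply/negP => /andP[eE eU]; move: (noW e).
by rewrite eE (subset_trans eU).
Qed.

Lemma sum1_subsets (V : finType) (W : {set V}) :
  (\sum_(U : {set V} | U \subset W) 1 = 2 ^ #|W|)%N.
Proof. by rewrite -card_powerset -sum1_card; apply: eq_bigl => U; rewrite inE. Qed.

Lemma edge_in_set (V : finType) (E : {set {set V}}) (W : {set V}) :
  simple_graph E -> ~~ [forall e in E, ~~ (e \subset W)] ->
  exists u v, [/\ u != v, [set u; v] \in E, u \in W & v \in W].
Proof.
move=> /forall_inP sg /forallPn[e]; rewrite negb_imply negbK => /andP[eE eW].
have /cards2P[u [v [uv e_uv]]] := sg e eE.
move: eW; rewrite e_uv subUset !sub1set => /andP[uW vW].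
by exists u, v; split=> //; rewrite -e_uv.
Qed.

Lemma eqn_add_le1 (l a b : nat) : (a < b)%N -> ((a == l) + (b == l) <= 1)%N.
Proof.
case: (eqVneq a l) => [-> lb|_ _]; first by rewrite gtn_eqF.
by rewrite add0n leq_b1.
Qed.

(** * Subsets of a fixed set with a prescribed number of edges *)

Lemma card_subsets_induced_le (V : finType) (E : {set {set V}}) (l : nat)
    (W : {set V}) : simple_graph E -> (0 < l)%N ->
  (4 * \sum_(U : {set V} | U \subset W) (#|induced_edges E U| == l)
   <= 3 * 2 ^ #|W|)%N.
Proof.
move=> sg l0; have [no|/(edge_in_set sg)] :=
  boolP [forall e in E, ~~ (e \subset W)].
  rewrite big1 ?muln0 // => U sUW.
  by rewrite (no_induced_edges no) // ltn_eqF.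
move=> [u] [v] [uv eE uW vW].
rewrite (sum_subsets_pick _ uW) (@sum_subsets_pick _ _ v); last first.
  by rewrite !inE eq_sym uv.
rewrite (cardsD1 u W) uW (cardsD1 v (W :\ u)) !inE eq_sym uv vW.
set X := #|_|; have -> : (3 * 2 ^ X.+2 = 4 * (3 * 2 ^ X))%N by rewrite !expnS; lia.
rewrite leq_mul2l /= -sum1_subsets big_distrr /=; apply: leq_sum => U; rewrite subsetD1.
move=> /andP[_ vU].
have := @ltn_induced_edges _ E [set u; v] U (u |: (v |: U)) eE.
rewrite setUA subsetUr subsetUl subUset !sub1set (negbTE vU) andbF /=.
move=> /(_ isT isT isT).
(* The four terms are regrouped so that [U] stands next to [U + u + v]. Their edge counts differ, so
   this pair contributes at most 1 and the other pair at most 2. *)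
move=> lt; rewrite [X in (_ + X)%N]addnC addnACA (@leq_add _ _ 1 2) ?eqn_add_le1 //.
by rewrite (@leq_add _ _ 1 1) ?leq_b1.
Qed.

Lemma induced_edges_setU1 (V : finType) (E : {set {set V}}) (u : V)
    (U : {set V}) : simple_graph E ->
  [forall w in U, [set u; w] \notin E] ->
  induced_edges E (u |: U) = induced_edges E U.
Proof.
move=> /forall_inP sg /forall_inP nou; apply/eqP; rewrite eqEsubset andbC.
rewrite induced_edgesS ?subsetUr //=; apply/subsetP => e.
rewrite !inE => /andP[eE]; rewrite eE /=.
have nbr w : w \in u |: U -> [set u; w] \in E -> w = u.
  by case/setU1P=> // wU uwE; have := nou w wU; rewrite uwE.
have /cards2P[x [y [xy e_xy]]] := sg e eE.
move: eE; rewrite {e}e_xy => eE; rewrite !subUset !sub1set => /andP[xU yU].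
have xu : x != u.
  by apply: contraNneq xy => xu; rewrite xu (nbr y) // -xu.
have yu : y != u.
  by apply: contraNneq xy => yu; rewrite yu (nbr x) // setUC -yu.
by move: xU yU; rewrite !in_setU1 (negbTE xu) (negbTE yu) /= => -> ->.
Qed.

Lemma card_subsets_one_edge_le (V : finType) (E : {set {set V}})
    (W : {set V}) : simple_graph E ->
  (2 * \sum_(U : {set V} | U \subset W) (#|induced_edges E U| == 1%N)
   <= 2 ^ #|W|)%N.
Proof.
move=> sg; have [m] := ubnP #|W|; elim: m W => // m IHm W /ltnSE leWm.
have [no|/(edge_in_set sg)] := boolP [forall e in E, ~~ (e \subset W)].
  rewrite big1 ?muln0 // => U sUW.
  by rewrite (no_induced_edges no) .
move=> [u] [v] [uv eE uW vW].
have vWu : v \in W :\ u by rewrite !inE eq_sym uv.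
have cW : #|W| = #|W :\ u :\ v|.+2.
  by rewrite (cardsD1 u W) uW (cardsD1 v (W :\ u)) vWu.
rewrite (sum_subsets_pick _ uW) (sum_subsets_pick _ vWu).
(* If U meets a neighbourhood of u or v, at most two of U, U + u, U + v and
   U + u + v induce one edge. Otherwise U lies in W3 and the first three induce
   equally many edges; the induction hypothesis for W3 absorbs the excess. *)
pose W3 := [set w in W :\ u :\ v | ([set u; w] \notin E) && ([set v; w] \notin E)].
have sW3 : W3 \subset W :\ u :\ v.
  by apply/subsetP => w; rewrite inE => /andP[].
have /IHm IH : (#|W3| < m)%N.
  by have := subset_leq_card sW3; lia.
pose nE A := #|induced_edges E A|.
suff H : (\sum_(U : {set V} | U \subset W :\ u :\ v)
   ((nE U == 1%N) + (nE (u |: U) == 1%N) +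
    ((nE (v |: U) == 1%N) + (nE (u |: (v |: U)) == 1%N)))
   + \sum_(U : {set V} | U \subset W3) 1
   <= \sum_(U : {set V} | U \subset W :\ u :\ v) 2 +
      2 * \sum_(U : {set V} | U \subset W3) (nE U == 1%N))%N.
  (* By the induction hypothesis the last term of [H] is at most [2 ^ #|W3|], which cancels against
     the second sum on the left. *)
  move: H; rewrite /nE sum1_subsets.
  have -> : (\sum_(U : {set V} | U \subset W :\ u :\ v) 2 = 2 * 2 ^ #|W :\ u :\ v|)%N.
    by rewrite -sum1_subsets big_distrr.
  rewrite cW !expnS; move: IH.
  set X := (\sum_(U : {set V} | _) _)%N; set Y := (\sum_(U : {set V} | _) _)%N.
  by move: X Y (2 ^ _)%N (2 ^ _)%N => ? ? ? ?; lia.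
have sumW3 F : (\sum_(U : {set V} | U \subset W3) F U =
    \sum_(U : {set V} | U \subset W :\ u :\ v) if U \subset W3 then F U else 0)%N.
  rewrite -big_mkcondr /=; apply: eq_bigl => U.
  by case: (boolP (U \subset W3)) => [s3|_]; rewrite ?andbF // (subset_trans s3).
rewrite !sumW3 big_distrr -!big_split /=; apply: leq_sum => U sU.
have uU : u \notin U.
  by apply/negP => /(subsetP sU); rewrite !inE eqxx andbF.
have vU : v \notin U.
  by apply/negP => /(subsetP sU); rewrite !inE eqxx.
have lt_u : (nE (u |: U) < nE (u |: (v |: U)))%N.
  apply: (@ltn_induced_edges _ _ [set u; v]) => //.
  - by rewrite setUS // subsetUr.
  - by rewrite setUA subsetUl.
  - by rewrite subUset !sub1set !inE eq_sym (negbTE uv) (negbTE vU) /= andbF.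
have lt_v : (nE (v |: U) < nE (u |: (v |: U)))%N.
  apply: (@ltn_induced_edges _ _ [set u; v]) => //.
  - by rewrite subsetUr.
  - by rewrite setUA subsetUl.
  - by rewrite subUset !sub1set !inE (negbTE uv) (negbTE uU).
case: ifPn => [sU3|]; last first.
  (* Adding to [U] the one of [u], [v] that is adjacent to [w] gains an edge. The quadruple then
     splits into two pairs with distinct edge counts, each contributing at most 1. *)
  move=> /subsetPn[w wU]; rewrite inE (subsetP sU) //= negb_and !negbK.
  case/orP => eW.
  - have ltu : (nE U < nE (u |: U))%N.
      apply: (@ltn_induced_edges _ _ [set u; w]) => //; first exact: subsetUr.
      + by rewrite setUS // sub1set.
      + by rewrite subUset !sub1set (negbTE uU).
    by rewrite addn0 muln0 addn0 (@leq_add _ _ 1 1) ?eqn_add_le1.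
  - have ltv : (nE U < nE (v |: U))%N.
      apply: (@ltn_induced_edges _ _ [set v; w]) => //; first exact: subsetUr.
      + by rewrite setUS // sub1set.
      + by rewrite subUset !sub1set (negbTE vU).
    by rewrite addn0 muln0 addn0 addnACA (@leq_add _ _ 1 1) ?eqn_add_le1.
have eu : nE (u |: U) = nE U.
  rewrite /nE induced_edges_setU1 //; apply/forall_inP => w /(subsetP sU3).
  by rewrite inE => /and3P[].
have ev : nE (v |: U) = nE U.
  rewrite /nE induced_edges_setU1 //; apply/forall_inP => w /(subsetP sU3).
  by rewrite inE => /and3P[].
(* If [U] induces one edge, both sides equal 4, since [U + u + v] has more than one edge. Otherwise
   only [U + u + v] can count, and the left side is at most 2. *)
rewrite eu ev in lt_u *; case: (eqVneq (nE U) 1%N) lt_u => [-> lt_u|_ _] /=.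
  by rewrite gtn_eqF.
by rewrite !add0n addn1 ltnS leq_b1.
Qed.

(** * Averaging over subsets of a given size *)

Lemma card_ksubsets (V : finType) (k : nat) : #|ksubsets V k| = 'C(#|V|, k).
Proof. exact: card_draws. Qed.

(** Complementation maps these supersets onto the subsets of [~: A] of size [#|V| - j]. *)
Lemma card_ksupersets (V : finType) (A : {set V}) (j : nat) : (j <= #|V|)%N ->
  #|[set B in ksubsets V j | A \subset B]| = 'C(#|V| - #|A|, #|V| - j).
Proof.
move=> jV; have -> : (#|V| - #|A| = #|~: A|)%N by rewrite [RHS]cardsCs setCK.
rewrite -cards_draws -(card_imset _ (@setC_inj V)).
apply: eq_card => B; rewrite 2!inE; apply/andP/imsetP => [[/eqP cB AB]|[C]]; last first.
  rewrite inE => /andP[sCA /eqP cC] ->; rewrite finset.subsetC sCA; split=> //.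
  by rewrite cardsCs setCK cC subKn.
exists (~: B); rewrite ?setCK // inE setCS AB /=.
by rewrite cardsCs setCK cB.
Qed.

Lemma sum_ksubsets_double (R : numFieldType) (V : finType)
    (f : {set V} -> R) (i j : nat) : (j <= #|V|)%N ->
  \sum_(B in ksubsets V j) \sum_(A in ksubsets V i | A \subset B) f A =
  'C(#|V| - i, #|V| - j)%:R * \sum_(A in ksubsets V i) f A.
Proof.
move=> jV; rewrite (exchange_big_dep (mem (ksubsets V i))) /=; last first.
  by move=> B A _ /andP[].
rewrite big_distrr; apply: eq_bigr => A Ai /=.
rewrite sumr_const mulr_natl; congr (_ *+ _).
move: (Ai); rewrite inE => /eqP<-; rewrite -card_ksupersets //.
by apply: eq_card => B; rewrite !inE eqxx unfold_in /= inE.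
Qed.

Lemma card_ksubsets_in (V : finType) (B : {set V}) (i : nat) :
  #|[set A in ksubsets V i | A \subset B]| = 'C(#|B|, i).
Proof. by rewrite -cards_draws; apply: eq_card => A; rewrite !inE andbC. Qed.

(** A uniform [i]-subset of a uniform [j]-subset of [V] is a uniform [i]-subset of [V]. This is used
    both to average over [W] and to delete random vertices from a [k]-set. *)
Lemma mean_ksubsets (R : numFieldType) (V : finType)
    (f : {set V} -> R) (i j : nat) : (i <= j <= #|V|)%N ->
  (\sum_(B in ksubsets V j) \sum_(A in ksubsets V i | A \subset B) f A)
    / 'C(#|V|, j)%:R =
  'C(j, i)%:R * ((\sum_(A in ksubsets V i) f A) / 'C(#|V|, i)%:R).
Proof.
move=> /andP[ij jV].
(* The constant function 1 yields the binomial identity ['C(n, j) * 'C(j, i) = 'C(n - i, n - j) *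
   'C(n, i)] with [n = #|V|]. *)
have /eqP := sum_ksubsets_double (fun=> 1 : R) i jV.
rewrite [in X in _ == X]sumr_const card_ksubsets.
under eq_bigr => B Bj.
  rewrite sumr_const -(_ : #|[set A in ksubsets V i | A \subset B]| = #|_|); last first.
    by apply: eq_card => A; rewrite [LHS]inE [RHS]unfold_in.
  rewrite card_ksubsets_in; move: (Bj); rewrite inE => /eqP->; over.
rewrite sumr_const card_ksubsets -mulr_natr => /eqP H.
rewrite sum_ksubsets_double //.
have Cj0 : 'C(#|V|, j)%:R != 0 :> R by rewrite pnatr_eq0 -lt0n bin_gt0.
have Ci0 : 'C(#|V|, i)%:R != 0 :> R.
  by rewrite pnatr_eq0 -lt0n bin_gt0 (leq_trans ij).
set S := \sum_(A in _) f A.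
transitivity ('C(#|V| - i, #|V| - j)%:R * 'C(#|V|, i)%:R * S
    / ('C(#|V|, i)%:R * 'C(#|V|, j)%:R)); first by field; rewrite Ci0 Cj0.
by rewrite mul1r in H; rewrite -H; field; rewrite Ci0 Cj0.
Qed.

Lemma prob_edgesE (R : realType) (V : finType) (E : {set {set V}}) (k l : nat) :
  prob_edges R E k l =
  (\sum_(A in ksubsets V k) (#|induced_edges E A| == l)%:R) / 'C(#|V|, k)%:R.
Proof.
rewrite /prob_edges card_ksubsets -sum1_card natr_sum; congr (_ / _).
rewrite [RHS](bigID (fun A => #|induced_edges E A| == l)) /= [X in _ + X]big1 ?addr0.
  by apply: eq_big => [A|A]; rewrite inE // => /andP[_ ->].
by move=> A /andP[_ /negbTE->].
Qed.

Lemma sum_bin_prob_edges_le (R : realType) (V : finType) (E : {set {set V}})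
    (N l : nat) (c : R) : (N <= #|V|)%N ->
  (forall W : {set V}, #|W| = N ->
    (\sum_(U : {set V} | U \subset W) (#|induced_edges E U| == l))%:R
      <= c * 2 ^+ N) ->
  \sum_(m < N.+1) 'C(N, m)%:R * prob_edges R E m l <= c * 2 ^+ N.
Proof.
move=> NV Hc; under eq_bigr => m _.
  rewrite prob_edgesE -mean_ksubsets; last by rewrite -ltnS ltn_ord.
  over.
rewrite -mulr_suml exchange_big /= ler_pdivrMr ?ltr0n ?bin_gt0 //.
rewrite mulr_natr -card_ksubsets -sumr_const; apply: ler_sum => W.
rewrite inE => /eqP cW; apply: le_trans (Hc W cW).
(* The subsets of [W] are sorted by size; [inord] loses nothing because [#|U| <= N]. *)
rewrite natr_sum (partition_big (fun U : {set V} => inord #|U| : 'I_N.+1) xpredT) //=.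
apply: ler_sum => m _; rewrite le_eqVlt; apply/orP; left; apply/eqP.
apply: eq_bigl => U; rewrite inE andbC; case: (boolP (U \subset W)) => //= UW.
by rewrite -val_eqE /= inordK // ltnS -cW subset_leq_card.
Qed.

(** * Deleting random vertices from a set with [l] edges *)

Lemma card_ksubsets_induced_ge (V : finType) (E : {set {set V}})
    (B : {set V}) (m l : nat) : simple_graph E -> #|induced_edges E B| = l ->
  (#|B| * 'C(#|B|, m) <=
   #|B| * #|[set A in ksubsets V m | (A \subset B) && (#|induced_edges E A| == l)]|
   + 2 * l * (#|B| - m) * 'C(#|B|, m))%N.
Proof.
move=> /forall_inP sg el; set S := cover (induced_edges E B).
set good := [set A in _ | _].
have cS : (#|S| <= 2 * l)%N.
  apply: leq_trans (leq_card_cover _) _; rewrite -el mulnC -sum_nat_const.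
  by apply: leq_sum => e; rewrite inE => /andP[/sg/eqP->]. 
(* [S] consists of the endpoints of the edges inside [B]. A subset of [B] containing [S] keeps all
   [l] edges, and any other one misses some [s] in [S], which allows a union bound. *)
have sub : [set A in ksubsets V m | A \subset B] \subset
    good :|: \bigcup_(s in S) [set A in ksubsets V m | A \subset B :\ s].
  apply/subsetP => A; rewrite in_setU 3!inE => /andP[cA AB].
  have [SA|/subsetPn[s sS sA]] := boolP (S \subset A).
    apply/orP; left; rewrite inE cA AB /= -el; apply/eqP; congr #|pred_of_set _|.
    apply/eqP; rewrite eqEsubset induced_edgesS //=; apply/subsetP => e eB.
    move: (eB); rewrite !inE => /andP[-> _] /=; apply: subset_trans SA.
    exact: (bigcup_sup e).
  apply/orP; right; apply/bigcupP; exists s => //.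
  by rewrite !inE cA subsetD1 AB.
have SB : S \subset B by apply/bigcupsP => e; rewrite inE => /andP[].
have := subset_leq_card sub; rewrite card_ksubsets_in => H.
have {}H : ('C(#|B|, m) <= #|good| + #|S| * 'C(#|B|.-1, m))%N.
  apply: leq_trans H _; apply: leq_trans (leq_card_setU _ _) _.
  rewrite leq_add2l -sum_nat_const.
  apply: (@leq_trans (\sum_(s in S) #|[set A in ksubsets V m | A \subset B :\ s]|)).
    elim/big_ind2: _ => [|x X y Y hx hy|//]; first by rewrite cards0.
    by apply: leq_trans (leq_card_setU _ _) _; exact: leq_add.
  apply: leq_sum => s /(subsetP SB) sB.
  by rewrite card_ksubsets_in (cardsD1 s B) sB.
apply: leq_trans (leq_mul (leqnn #|B|) H) _.
(* The factor [#|B|] avoids a division: [#|B| * 'C(#|B|.-1, m) = (#|B| - m) * 'C(#|B|, m)]. *)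
rewrite mulnDr leq_add2l mulnCA mul_bin_down -mulnA leq_mul2r cS orbT //.
Qed.

Lemma prob_edges_smaller_ge (R : realType) (V : finType) (E : {set {set V}})
    (m k l : nat) : simple_graph E -> (0 < k)%N -> (m <= k <= #|V|)%N ->
  (1 - 2 * l%:R * (k%:R - m%:R) / k%:R) * prob_edges R E k l
    <= prob_edges R E m l.
Proof.
move=> sg k0 /andP[mk kV].
have Ck0 : 0 < 'C(k, m)%:R :> R by rewrite ltr0n bin_gt0.
rewrite -(ler_pM2l Ck0) [in leRHS]prob_edgesE -mean_ksubsets ?mk //.
rewrite prob_edgesE !mulrA ler_pM2r ?invr_gt0 ?ltr0n ?bin_gt0 // mulr_sumr.
apply: ler_sum => B; rewrite inE => /eqP cB.
have [/eqP el|] := boolP (_ == l); last by rewrite mulr0 => _; apply: sumr_ge0.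
have := card_ksubsets_induced_ge m sg el; rewrite cB mulr1.
set g := #|_|; have -> : \sum_(A in ksubsets V m | A \subset B)
    (#|induced_edges E A| == l)%:R = g%:R :> R.
  rewrite /g -sum1_card natr_sum.
  rewrite (bigID (fun A => #|induced_edges E A| == l)) /= [X in _ + X]big1 ?addr0.
    apply: eq_big => [A|A]; first by rewrite !inE andbA.
    by move=> /andP[_ ->].
  by move=> A /andP[_ /negbTE->].
rewrite -(ler_nat R) natrD !natrM natrB // => H.
have k0R : 0 < k%:R :> R by rewrite ltr0n.
rewrite -(ler_pM2l k0R); apply: le_trans (_ : k%:R * 'C(k, m)%:R -
  2 * l%:R * (k%:R - m%:R) * 'C(k, m)%:R <= _); last by lra.
by rewrite le_eqVlt; apply/orP; left; apply/eqP; field; rewrite gt_eqF.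
Qed.

(** * Binomial variance and the bound for a fixed graph *)

Lemma sum_bin_sqr_dev (R : comNzRingType) (N : nat) :
  \sum_(m < N.+1) 'C(N, m)%:R * (2 * m%:R - N%:R) ^+ 2 = N%:R * 2 ^+ N :> R.
Proof.
(* The shift [x] makes the induction work: Pascal's rule splits the sum for [N + 1] into the sums
   for [N] shifted by [x - 1] and [x + 1]. *)
suff H (x : R) : \sum_(m < N.+1) 'C(N, m)%:R * (2 * m%:R - N%:R + x) ^+ 2 =
    (N%:R + x ^+ 2) * 2 ^+ N.
  have := H 0; rewrite expr0n addr0 => <-.
  by apply: eq_bigr => m _; rewrite addr0.
elim: N x => [|N IHN] x; first by rewrite big_ord1 bin0 /=; ring.
rewrite big_ord_recl /= bin0.
under eq_bigr => m _ do rewrite /bump /= add1n binS natrD mulrDl.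
rewrite big_split /= [X in _ + (X + _)]big_ord_recr /= bin_small // mul0r addr0.
have := IHN (x - 1); rewrite big_ord_recl /= bin0.
under eq_bigr => m _ do rewrite /bump /= add1n.
move=> H1; have H2 := IHN (x + 1).
rewrite [2 ^+ N.+1]exprS; transitivity
  ((N%:R + (x - 1) ^+ 2) * 2 ^+ N + (N%:R + (x + 1) ^+ 2) * 2 ^+ N);
  last by rewrite -(natr1 N); ring.
rewrite -H1 -H2 addrA -(natr1 N); congr (_ + _ + _); first by ring.
- by apply: eq_bigr => m _; ring.
- by apply: eq_bigr => m _; rewrite -(natr1 m); ring.
Qed.

Lemma prob_edges_ge0 (R : realType) (V : finType) (E : {set {set V}})
    (k l : nat) : 0 <= prob_edges R E k l.
Proof. exact: divr_ge0. Qed.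

Lemma prob_edges_le1 (R : realType) (V : finType) (E : {set {set V}})
    (k l : nat) : (k <= #|V|)%N -> prob_edges R E k l <= 1.
Proof.
move=> kV; rewrite /prob_edges ler_pdivrMr ?ltr0n ?card_ksubsets ?bin_gt0 //.
rewrite mul1r ler_nat -card_ksubsets subset_leq_card //.
by apply/subsetP => A; rewrite inE => /andP[].
Qed.

(* The factor is a quadratic in the deviation [d = m - (k - t)] from the mean,
   so its binomial average only needs the variance; it lies below
   [1 - 2 l (k - m) / k] for [m <= k] and below [0] for [m > k]. *)
Lemma prob_edges_dev_ge (R : realType) (V : finType) (E : {set {set V}})
    (k l m t : nat) : simple_graph E -> (0 < t)%N -> (t <= k <= #|V|)%N ->
  prob_edges R E k l * (1 - 4 * l%:R * t%:R / k%:R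
    - (2 * l%:R / (k%:R * t%:R) + t%:R ^- 2) * (m%:R - (k%:R - t%:R)) ^+ 2)
    <= prob_edges R E m l.
Proof.
move=> sg t0 /andP[tk kV].
have T0 : 0 < t%:R :> R by rewrite ltr0n.
have K0 : 0 < k%:R :> R by rewrite ltr0n (leq_trans t0).
have L0 : 0 <= l%:R :> R by [].
set d := m%:R - _; have [mk|km] := leqP m k.
  apply: le_trans (prob_edges_smaller_ge R l sg (leq_trans t0 tk) _); last first.
    by rewrite mk.
  rewrite [leRHS]mulrC ler_wpM2l ?prob_edges_ge0 // -subr_ge0.
  have -> : k%:R - m%:R = t%:R - d by rewrite /d; ring.
  (* The gap between the two factors is a positive semidefinite form in [t] and [d] plus a
     square. *)
  rewrite (_ : _ - _ = 2 * l%:R / (k%:R * t%:R) * (t%:R ^+ 2 + d * t%:R + d ^+ 2)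
     + (d / t%:R) ^+ 2); last by field; rewrite !gt_eqF.
  apply: addr_ge0 (sqr_ge0 _); apply: mulr_ge0; last by nra.
  by rewrite divr_ge0 ?mulr_ge0 // ltW.
apply: le_trans (prob_edges_ge0 _ _ _ _).
rewrite mulr_ge0_le0 ?prob_edges_ge0 //.
have td : t%:R <= d.
  by have := ltnW km; rewrite -(ler_nat R) /d; lra.
(* The term [t ^- 2 * d ^+ 2] alone outweighs the constant 1 once [m > k], as in Chebyshev's
   inequality. *)
have dt : 1 <= (d / t%:R) ^+ 2.
  by rewrite exprn_ege1 // ler_pdivlMr // mul1r.
have ? : 0 <= 4 * l%:R * t%:R / k%:R :> R.
  by rewrite divr_ge0 ?mulr_ge0 // ltW.
have ? : 0 <= 2 * l%:R / (k%:R * t%:R) * d ^+ 2.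
  by rewrite mulr_ge0 ?sqr_ge0 // divr_ge0 ?mulr_ge0 // ltW.
have -> : (2 * l%:R / (k%:R * t%:R) + t%:R ^- 2) * d ^+ 2 =
    2 * l%:R / (k%:R * t%:R) * d ^+ 2 + (d / t%:R) ^+ 2.
  by field; rewrite !gt_eqF.
lra.
Qed.

Lemma prob_edges_le (R : realType) (V : finType) (E : {set {set V}})
    (k l t : nat) (c : R) : simple_graph E -> (0 < t)%N ->
  (t <= k)%N -> (2 * k <= #|V|)%N ->
  (forall W : {set V},
    (\sum_(U : {set V} | U \subset W) (#|induced_edges E U| == l))%:R
      <= c * 2 ^+ #|W|) ->
  prob_edges R E k l <=
    c + (4 * l%:R * t%:R / k%:R + l%:R / t%:R + k%:R / (2 * t%:R ^+ 2)).
Proof.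
move=> sg t0 tk kV Hc; have kV' : (k <= #|V|)%N by lia.
have T0 : 0 < t%:R :> R by rewrite ltr0n.
have K0 : 0 < k%:R :> R by rewrite ltr0n (leq_trans t0).
have L0 : 0 <= l%:R :> R by [].
set p := prob_edges R E k l; have p0 : 0 <= p by exact: prob_edges_ge0.
have p1 : p <= 1 by exact: prob_edges_le1.
(* With this [N] the binomial mean is [k - t], so the deviation is [(2 * m - N) / 2]; this explains
   the factor [b / 4] below. *)
pose N := (2 * (k - t))%N.
have NR : N%:R = 2 * (k%:R - t%:R) :> R by rewrite natrM natrB.
set a : R := 4 * l%:R * t%:R / k%:R.
set b : R := 2 * l%:R / (k%:R * t%:R) + t%:R ^- 2.
have b0 : 0 <= b by rewrite addr_ge0 ?divr_ge0 ?invr_ge0 ?mulr_ge0 ?exprn_ge0 // ltW.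
have : \sum_(m < N.+1) 'C(N, m)%:R * prob_edges R E m l <= c * 2 ^+ N.
  apply: sum_bin_prob_edges_le => [|W cW]; first by rewrite /N; lia.
  by rewrite -cW.
have : \sum_(m < N.+1) 'C(N, m)%:R * (p * (1 - a - b / 4 * (2 * m%:R - N%:R) ^+ 2))
    <= \sum_(m < N.+1) 'C(N, m)%:R * prob_edges R E m l.
  apply: ler_sum => m _; rewrite ler_wpM2l //.
  apply: le_trans (prob_edges_dev_ge R (k := k) l m sg t0 _); last by apply/andP.
  rewrite -/p -/a -/b NR ler_wpM2l // le_eqVlt; apply/orP; left; apply/eqP.
  by field.
have -> : \sum_(m < N.+1) 'C(N, m)%:R * (p * (1 - a - b / 4 * (2 * m%:R - N%:R) ^+ 2))
   = p * (1 - a) * \sum_(m < N.+1) 'C(N, m)%:R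
    - p * b / 4 * \sum_(m < N.+1) 'C(N, m)%:R * (2 * m%:R - N%:R) ^+ 2.
  by rewrite !mulr_sumr -sumrB; apply: eq_bigr => m _; field.
rewrite sum_bin_sqr_dev.
have -> : \sum_(m < N.+1) 'C(N, m)%:R = 2 ^+ N :> R.
  rewrite -natrX -[2%N]/(1 + 1)%N expnDn natr_sum.
  by apply: eq_bigr => m _; rewrite !exp1n !muln1.
move=> /le_trans H /H; rewrite !mulrA -mulrBl ler_pM2r ?exprn_gt0 //.
have bN : b / 4 * N%:R <= l%:R / t%:R + k%:R / (2 * t%:R ^+ 2).
  apply: (@le_trans _ _ (b / 4 * (2 * k%:R))).
    by rewrite ler_wpM2l ?divr_ge0 // NR; lra.
  by rewrite le_eqVlt; apply/orP; left; apply/eqP; rewrite /b; field; rewrite !gt_eqF.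
have a0 : 0 <= a by rewrite divr_ge0 ?mulr_ge0 // ltW.
(* Since [p <= 1], the bound [p * (1 - a - b / 4 * N) <= c] gives [p <= c + a + b / 4 * N]. *)
have : p * (a + b / 4 * N%:R) <= 1 * (a + b / 4 * N%:R).
  by rewrite ler_wpM2r // addr_ge0 // mulr_ge0 ?divr_ge0.
lra.
Qed.

(** * Passage to the limit and choice of parameters *)

Lemma ind_le (R : realType) (k l : nat) (c : R) : 0 <= c ->
  (forall n (E : {set {set 'I_n}}), (2 * k <= n)%N -> simple_graph E ->
    prob_edges R E k l <= c) ->
  ind R k l <= c.
Proof.
move=> c0 Hc; rewrite /ind.
have [cv|/dvgP ->] := pselect (cvgn (fun n => max_prob R n k l)); last first.
  (* a divergent sequence has the default limit [point], which is [0] in [R] *)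
  exact: c0.
apply: limr_le => //; near=> n; apply: bigmax_le => // E; apply: Hc.
by near: n; exact: nbhs_infty_ge.
Unshelve. all: by end_near. Qed.

Lemma ind_le_of_subset_count (R : realType) (l : nat) (c : R) : 0 <= c ->
  (forall n (E : {set {set 'I_n}}) (W : {set 'I_n}), simple_graph E ->
    (\sum_(U : {set 'I_n} | U \subset W) (#|induced_edges E U| == l))%:R
      <= c * 2 ^+ #|W|) ->
  forall eps : R, 0 < eps ->
  exists k0 : nat, forall k : nat, (k0 <= k)%N -> ind R k l <= c + eps.
Proof.
move=> c0 Hc eps e0.
have L0 : 0 <= l%:R :> R by [].
(* With [t = k %/ q], the first error term is at most [4 * l / q], and this [q] makes it at most
   [eps / 2]. The other two are at most [(2 * l * q + 2 * q ^ 2) / k], and [k1] makes them at most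
   [eps / 2] together. *)
pose q := (Num.truncn (8 * l%:R / eps)).+1.
have qe : 8 * l%:R < eps * q%:R.
  by rewrite -ltr_pdivrMl // mulrC truncnS_gt.
pose k1 := (Num.truncn ((4 * l%:R * q%:R + 4 * q%:R ^+ 2) / eps)).+1.
exists (q + k1)%N => k kk.
have q0 : 0 < q%:R :> R by rewrite ltr0n.
have ke : 4 * l%:R * q%:R + 4 * q%:R ^+ 2 < eps * k%:R.
  rewrite -ltr_pdivrMl // mulrC; apply: lt_le_trans (truncnS_gt _) _.
  by rewrite ler_nat; exact: leq_trans (leq_addl q k1) kk.
apply: ind_le => [|n E kn sg]; first by rewrite addr_ge0 // ltW.
pose t := (k %/ q)%N.
have t0 : (0 < t)%N by rewrite divn_gt0 //; lia.
have tk : (t <= k)%N by exact: leq_div.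
have tq : (t * q <= k)%N by exact: leq_divM.
(* As [t >= 1], rounding down costs at most a factor 2: [k < (t + 1) * q <= 2 * t * q]. *)
have kt : (k <= 2 * (t * q))%N by move: t0; rewrite /t; nia.
have T0 : 0 < t%:R :> R by rewrite ltr0n.
have K0 : 0 < k%:R :> R by rewrite ltr0n (leq_trans t0).
move: tq kt; rewrite -!(ler_nat R) !natrM => tq kt.
apply: le_trans (prob_edges_le sg t0 tk _ _) _; first by rewrite card_ord.
  by move=> W; apply: Hc.
rewrite lerD2l.
have B1 : 4 * l%:R * t%:R / k%:R <= eps / 2.
  rewrite ler_pdivrMr //.
  have := ler_wpM2r (ltW T0) (ltW qe); have := ler_wpM2l (ltW e0) tq; lra.
have B2 : l%:R / t%:R <= 2 * l%:R * q%:R / k%:R :> R.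
  rewrite ler_pdivrMr // mulrAC ler_pdivlMr //.
  by have := ler_wpM2l L0 kt; lra.
have B3 : k%:R / (2 * t%:R ^+ 2) <= 2 * q%:R ^+ 2 / k%:R :> R.
  rewrite ler_pdivrMr ?mulr_gt0 ?exprn_gt0 // mulrAC ler_pdivlMr //.
  have : k%:R ^+ 2 <= (2 * (t%:R * q%:R)) ^+ 2 :> R by rewrite lerXn2r ?nnegrE //; lra.
  lra.
have B4 : 2 * l%:R * q%:R / k%:R + 2 * q%:R ^+ 2 / k%:R <= eps / 2.
  by rewrite -[leLHS]mulrDl ler_pdivrMr //; lra.
lra.
Qed.

Theorem theorem1p6 (R : realType) :
  (forall l : nat, (0 < l)%N ->
   forall eps : R, 0 < eps ->
   exists k0 : nat, forall k : nat, (k0 <= k)%N ->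
     ind R k l <= 3%:R / 4%:R + eps)
  /\
  (forall eps : R, 0 < eps ->
   exists k0 : nat, forall k : nat, (k0 <= k)%N ->
     ind R k 1 <= 1 / 2%:R + eps).
Proof.
split=> [l l0|]; apply: ind_le_of_subset_count => // n E W sg.
  have := card_subsets_induced_le W sg l0.
  by rewrite -(ler_nat R) !natrM natrX; lra.
have := card_subsets_one_edge_le W sg.
by rewrite -(ler_nat R) !natrM natrX; lra.
Qed.
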